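(* Let $X \subset \mathbb{Z}^2$ be a digital disk. Let $S$ be a bounding curve for $X$. Let $p$ be the vertex of an interior angle of $S$ formed by axis-parallel edges $E_1$ and $E_2$ of $S$, of measure $90^{\circ}$ ($\pi/2$ radians). Let $X$ be $90^{\circ}$-thick at $p$. Let $A$ be a cold set for $(X,c_1)$. Then $p \in A$.
   Context: Adjacencies in $\mathbb{Z}^2$: distinct points $(x_1,x_2)$, $(y_1,y_2)$ are $c_2$-adjacent if $|x_i-y_i|\le 1$ for $i=1,2$; they are $c_1$-adjacent if moreover they differ in exactly one coordinate. For $\kappa\in\{c_1,c_2\}$ and $X\subset\mathbb{Z}^2$: a $\kappa$-path of length $k$ is a sequence $x_0,\dots,x_k$ with consecutive points equal or $\kappa$-adjacent; a set is $\kappa$-connected if any two of its points are joined by a $\kappa$-path in it; $d_\kappa(x,y)$ is the minimal length of a $\kappa$-path in $X$ from $x$ to $y$. $f:X\to X$ is in $C(X,\kappa)$ (is $\kappa$-continuous) if $\kappa$-adjacent points have equal or $\kappa$-adjacent images. For $(X,\kappa)$ connected, $A\subset X$ is a cold set if every $f\in C(X,\kappa)$ with $f|_A=\mathrm{id}_A$ satisfies $d_\kappa(x,f(x))\le 1$ for all $x\in X$. A $c_2$-closed curve is a $c_2$-path $\{s_i\}_{i=0}^m$ with $s_0=s_m$ and $s_i\ne s_j$ whenever $0<|i-j|<m$. If $S\subset\mathbb{Z}^2$ is a $c_2$-closed curve such that $\mathbb{Z}^2\setminus S$ has two $c_1$-components, one finite and the other infinite, the finite one is denoted $Int(S)$ and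 the infinite one $Ext(S)$; then $D=S\cup Int(S)$ is a digital disk, $S$ is a bounding curve of $D$, and $Int(D)$ denotes $Int(S)$ when $S$ is understood. A digital line segment is a ($c_1$- or $c_2$-)connected collinear set of more than one point of $\mathbb{Z}^2$; it is horizontal or vertical (axis-parallel) or has slope $\pm1$ (slanted). The edges (sides) of $S$ are the maximal digital line segments in $S$. If edges $E_1,E_2$ of $S$ satisfy $E_1\cap E_2=\{p\}$, the interior angle at the vertex $p$ is the angle formed by $E_1$, $E_2$ and $Int(S)$. $90^\circ$-thickness (axis-parallel sides): if $p$ is the vertex of a $90^\circ$ interior angle $\theta$ of $S$ with axis-parallel sides, $X$ is $90^\circ$-thick at $p$ if there exists $q\in Int(X)$, in the interior of $\theta$, that is $c_2$-adjacent but not $c_1$-adjacent to $p$.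
   Formalization: Added to the notion of interior angle: p is an end point of both E1 and E2, and no point of Int(S) c2-adjacent to p lies strictly inside the complementary angle; otherwise (e.g. where an edge passes through p, as at a double-width inward spur) X∖{p} is cold and the claim fails. *)

(* Defs.v *)
From HB Require Import structures.
From mathcomp Require Import all_boot all_order all_algebra.
From mathcomp Require Import boolp classical_sets cardinality.
Set Implicit Arguments. Unset Strict Implicit. Unset Printing Implicit Defensive.
Import Order.TTheory GRing.Theory Num.Theory.
Local Open Scope classical_set_scope.
Local Open Scope ring_scope.

Definition Z2 : Type := (int * int)%type.

(** ** Adjacency, paths, connectedness, continuity *)

Definition c2 : rel Z2 := fun x y =>
  [&& x != y, `|x.1 - y.1| <= 1 & `|x.2 - y.2| <= 1].

Definition c1 : rel Z2 := fun x y =>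
  c2 x y && ((x.1 != y.1) (+) (x.2 != y.2)).

(* Only the values s 0, ..., s k matter. *)
Definition kpath (K : rel Z2) (X : set Z2) (k : nat) (s : nat -> Z2) :=
  (forall i, (i <= k)%N -> X (s i)) /\
  (forall i, (i < k)%N -> s i = s i.+1 \/ K (s i) (s i.+1)).

Definition joined (K : rel Z2) (X : set Z2) (x y : Z2) (k : nat) :=
  exists s, [/\ kpath K X k s, s 0%N = x & s k = y].

Definition kconnected (K : rel Z2) (X : set Z2) :=
  forall x y, X x -> X y -> exists k, joined K X x y k.

(* [kdist K X x y n] : n is the distance d_K(x, y) in X.  It is a relation
   because the distance is only defined when x and y are joined in X. *)
Definition kdist (K : rel Z2) (X : set Z2) (x y : Z2) (n : nat) :=
  joined K X x y n /\ forall k, joined K X x y k -> (n <= k)%N.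

(* Self-maps of X are represented by total maps, of which only the values on X
   are ever used. *)
Definition kcontinuous (K : rel Z2) (X : set Z2) (f : Z2 -> Z2) :=
  (forall x, X x -> X (f x)) /\
  (forall x y, X x -> X y -> K x y -> f x = f y \/ K (f x) (f y)).

Definition cold_set (K : rel Z2) (X A : set Z2) :=
  [/\ kconnected K X, A `<=` X &
      forall f, kcontinuous K X f -> (forall x, A x -> f x = x) ->
        forall x, X x -> exists2 n, kdist K X x (f x) n & (n <= 1)%N].

(** ** Closed curves and digital disks *)

Definition c2_closed_curve (S : set Z2) :=
  exists m (s : nat -> Z2),
    [/\ kpath c2 S m s, S = s @` [set i | (i <= m)%N], s 0%N = s m &
        forall i j, (i < j <= m)%N -> (j - i < m)%N -> s i <> s j].

Definition component (K : rel Z2) (Y C : set Z2) :=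
  [/\ C !=set0, C `<=` Y, kconnected K C &
      forall C', C `<=` C' -> C' `<=` Y -> kconnected K C' -> C' = C].

Definition separates (S : set Z2) :=
  exists I E : set Z2,
    [/\ component c1 (~` S) I /\ finite_set I,
        component c1 (~` S) E /\ ~ finite_set E &
        forall C, component c1 (~` S) C -> C = I \/ C = E].

(* When [separates S] holds, these unions have a single member. *)
Definition Int (S : set Z2) : set Z2 :=
  \bigcup_(C in [set C | component c1 (~` S) C /\ finite_set C]) C.

Definition Ext (S : set Z2) : set Z2 :=
  \bigcup_(C in [set C | component c1 (~` S) C /\ ~ finite_set C]) C.

Definition bounding_curve (S X : set Z2) :=
  [/\ c2_closed_curve S, separates S & X = S `|` Int S].

Definition digital_disk (X : set Z2) := exists S, bounding_curve S X.

(** ** Edges *)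

Definition collinear (L : set Z2) :=
  exists a b c : int, (a, b) != (0, 0) /\
    forall x, L x -> a * x.1 + b * x.2 = c.

Definition digital_segment (L : set Z2) :=
  [/\ kconnected c1 L \/ kconnected c2 L, collinear L &
      exists x y, [/\ L x, L y & x <> y]].

Definition edge (S E : set Z2) :=
  [/\ digital_segment E, E `<=` S &
      forall L, digital_segment L -> E `<=` L -> L `<=` S -> L = E].

Definition horizontal (L : set Z2) := forall x y, L x -> L y -> x.2 = y.2.
Definition vertical (L : set Z2) := forall x y, L x -> L y -> x.1 = y.1.
Definition axis_parallel (L : set Z2) := horizontal L \/ vertical L.

(** ** Angles *)

(* The eight directions, counterclockwise by steps of 45 degrees, starting
   from the positive first axis; the index is read modulo 8. *)
Definition dir (a : nat) : Z2 :=
  nth (0, 0) [:: (1, 0); (1, 1); (0, 1); (-1, 1);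
                 (-1, 0); (-1, -1); (0, -1); (1, -1)] (a %% 8)%N.

(* The angle swept counterclockwise about [vertex], from direction
   [dir start], through [width] steps of 45 degrees. *)
Record angle := Angle { vertex : Z2; start : nat; width : nat }.

Definition degrees (t : angle) : nat := (45 * width t)%N.

Definition opposite_angle (t : angle) :=
  Angle (vertex t) (start t + width t) (8 - width t).

(* Lattice points strictly inside the angle.  Consecutive directions form a
   basis of Z^2 and span the lattice points of the cone between them; the third
   condition removes the starting ray, and the final ray is never reached since
   j < width t and 0 < m. *)
Definition angle_interior (t : angle) : set Z2 := [set q |
  exists j m n : nat,
    [/\ (j < width t)%N, (0 < m)%N, (0 < j)%N \/ (0 < n)%N &
        q = vertex t + dir (start t + j) *+ m + dir (start t + j.+1) *+ n]].

(* For a digital segment E: p is an end point of E, and E leaves p in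
   direction [dir a]. *)
Definition leaves (E : set Z2) (p : Z2) (a : nat) :=
  E p /\ forall x, E x -> exists n : nat, x = p + dir a *+ n.

(* Two edges with common end point p bound two complementary angles at p; the
   interior angle is the one on the side of Int S, that is, near p (among the
   c2-neighbours of p) there is no point of Ext S strictly inside it and no
   point of Int S strictly inside the complementary angle.  The angle itself
   need not contain a point of Int S near p: the c2-neighbours of p strictly
   inside it may belong to S. *)
Definition interior_angle (S E1 E2 : set Z2) (t : angle) :=
  let p := vertex t in
  [/\ edge S E1 /\ edge S E2,
      E1 `&` E2 = [set p],
      (0 < width t < 8)%N,
      (leaves E1 p (start t) /\ leaves E2 p (start t + width t)) \/
      (leaves E2 p (start t) /\ leaves E1 p (start t + width t)) &
      forall q, c2 p q ->
        (angle_interior t q -> ~ Ext S q) /\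
        (angle_interior (opposite_angle t) q -> ~ Int S q)].

(* S is the bounding curve, so that Int S is the interior of the disk; meant
   for a 90 degree interior angle t of S with axis-parallel sides. *)
Definition thick90 (S : set Z2) (t : angle) :=
  exists q, [/\ Int S q, angle_interior t q,
                c2 (vertex t) q & ~~ c1 (vertex t) q].

(* Main.v *)
Require Import Defs.
From mathcomp Require Import all_boot all_order all_algebra.
From mathcomp Require Import boolp classical_sets cardinality.
From mathcomp Require Import zify ring.

(** The interior angle at [p] has sides in the directions [d] and [e], and
    thickness puts [p + d + e] in the disk.  By maximality of the edges [p - d]
    and [p - e] are not on the curve, and they lie strictly inside the
    complementary angle, so they are not in the disk.  Hence every
    [c1]-neighbour of [p] in the disk is [p + d] or [p + e], both
    [c1]-adjacent to [p + d + e], and the map sending [p] to [p + d + e] and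
    fixing all other points is [c1]-continuous.  It moves [p] by a distance
    greater than 1, so it cannot fix a cold set pointwise. *)

Set Implicit Arguments.
Unset Strict Implicit.
Unset Printing Implicit Defensive.
Import Order.TTheory GRing.Theory Num.Theory.
Local Open Scope classical_set_scope.
Local Open Scope ring_scope.

Lemma Z2_mulrn (x : Z2) (n : nat) : x *+ n = (x.1 * n%:Z, x.2 * n%:Z).
Proof.
elim: n => [|n IHn]; first by rewrite mulr0n !mulr0.
by rewrite mulrS IHn; congr pair => /=; lia.
Qed.

Lemma c1P (x y : Z2) :
  c1 x y <-> `|x.1 - y.1| + `|x.2 - y.2| = 1.
Proof. case: x y => [x1 x2] [y1 y2]; rewrite /c1 /c2 /= xpair_eqE; lia. Qed.

Lemma c1_sym : symmetric c1.
Proof. by move=> x y; apply/idP/idP => /c1P h; apply/c1P; lia. Qed.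

Lemma c2_sym : symmetric c2.
Proof. by move=> x y; rewrite /c2 eq_sym !(distrC x.1) !(distrC x.2). Qed.

Lemma c1_sub_c2 : subrel c1 c2.
Proof. by move=> x y /andP[]. Qed.

Section Joined.
Variable K : rel Z2.
Implicit Types (X Y : set Z2) (x y z : Z2).

Lemma joined_sym X x y k : symmetric K -> joined K X x y k -> joined K X y x k.
Proof.
move=> symK [s [[sX sK] s0 sk]]; exists (fun i => s (k - i)%N); split.
- split=> i ik; first by apply: sX; lia.
  have -> : (k - i = (k - i.+1).+1)%N by lia.
  by have [->|Ks] := sK (k - i.+1)%N ltac:(lia); [left|right; rewrite symK].
- by rewrite subn0.
- by rewrite subnn.
Qed.

Lemma joined_sub X Y x y k : X `<=` Y -> joined K X x y k -> joined K Y x y k.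
Proof.
move=> XY [s [[sX sK] s0 sk]].
by exists s; split=> //; split=> // i /sX /XY.
Qed.

Lemma joined0 X x : X x -> joined K X x x 0.
Proof. by move=> Xx; exists (fun=> x). Qed.

Lemma joined_rcons X x y z k :
  X z -> K y z -> joined K X x y k -> joined K X x z k.+1.
Proof.
move=> Xz Kyz [s [[sX sK] s0 sk]].
exists (fun i => if (i <= k)%N then s i else z); split=> //; last by rewrite ltnn.
split=> i ik; first by case: ifP => // /sX.
rewrite -ltnS ik; case: ltnP => [/sK//|ki].
by have -> : i = k by [lia]; rewrite sk; right.
Qed.

(** Serves to lengthen a digital segment by one point while keeping it connected. *)
Lemma kconnected_adjoin X y z :
  symmetric K -> X y -> K y z -> kconnected K X -> kconnected K (X `|` [set z]).
Proof.
move=> symK Xy Kyz conX.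
have XXz : X `<=` X `|` [set z] by left.
have toz x : X x -> exists k, joined K (X `|` [set z]) x z k.
  move=> Xx; have [k xy] := conX _ _ Xx Xy.
  by exists k.+1; apply: (joined_rcons _ Kyz (joined_sub XXz xy)); right.
move=> u v [Xu|->] [Xv|->].
- by have [k uv] := conX _ _ Xu Xv; exists k; apply: joined_sub uv.
- exact: toz.
- by have [k vz] := toz _ Xv; exists k; apply: joined_sym.
- by exists 0%N; apply: joined0; right.
Qed.

End Joined.

(** Over the integers the first equation leaves only the four axis unit vectors; [e] is then [d]
    turned counterclockwise by 90 degrees. *)
Definition axis_frame (d e : Z2) :=
  `|d.1| + `|d.2| = 1 /\ e = (- d.2, d.1).

(** If [p - dir a] were on [S], adjoining it to [E] would give a digital segment in [S], so
    maximality would put it in [E], behind the end point [p]. *)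
Lemma edge_no_extension (S E : set Z2) (p : Z2) (a : nat) :
  edge S E -> leaves E p a -> `|(dir a).1| + `|(dir a).2| = 1 ->
  ~ S (p - dir a).
Proof.
move=> [[conE _ [x [y [Ex Ey xy]]]] ES maxE] [Ep pE]; set d := dir a => d1 Sr.
have adj : c1 p (p - d) by apply/c1P => /=; lia.
have EEr : E `<=` E `|` [set p - d] by left.
have Er : E (p - d).
  rewrite -(maxE (E `|` [set p - d])) //; first by right.
    split.
    - case: conE => conE; [left|right].
        exact: (kconnected_adjoin c1_sym Ep adj conE).
      exact: (kconnected_adjoin c2_sym Ep (c1_sub_c2 adj) conE).
    (* The line through [p] in direction [d], with normal vector [(- d.2, d.1)]. *)
    - exists (- d.2), d.1, (- d.2 * p.1 + d.1 * p.2); split.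
        by rewrite xpair_eqE; lia.
      move=> z [/pE[n ->]|->] /=; rewrite ?Z2_mulrn /=; ring.
    - by exists x, y; split=> //; apply: EEr.
  by move=> z [/ES|->].
(* Here [p - d = p + d *+ n] would force the natural number [n] to be -1. *)
have [n] := pE _ Er; rewrite Z2_mulrn -/d => -[/= h1 h2]. nia.
Qed.

(** Two distinct points of [E] differ by a nonzero multiple of [dir a]; were [dir a] diagonal, both
    coordinates would differ. *)
Lemma leaves_axis (S E : set Z2) (p : Z2) (a : nat) :
  edge S E -> leaves E p a -> axis_parallel E ->
  `|(dir a).1| + `|(dir a).2| = 1.
Proof.
move=> [[_ _ [x [y [Ex Ey xy]]]] _ _] [_ pE] axE.
have [m xm] := pE _ Ex; have [n yn] := pE _ Ey.
have mn : m <> n by move=> mn; apply: xy; rewrite xm yn mn.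
have {axE} : x.1 = y.1 \/ x.2 = y.2.
  by case: axE => axE; [right|left]; apply: axE.
rewrite xm yn !Z2_mulrn /dir /=.
have := ltn_pmod a (isT : 0 < 8)%N.
by case: (a %% 8)%N => [|[|[|[|[|[|[|[|//]]]]]]]] _ /=; lia.
Qed.

Lemma dir_mod (a b : nat) : dir (a + b) = dir (a %% 8 + b).
Proof. by rewrite /dir modnDml. Qed.

Lemma dir_axis (a : nat) : `|(dir a).1| + `|(dir a).2| = 1 ->
  [/\ axis_frame (dir a) (dir (a + 2)), dir (a + 1) = dir a + dir (a + 2),
      dir (a + 4) = - dir a & dir (a + 6) = - dir (a + 2)].
Proof.
rewrite -[a in dir a]addn0 !(dir_mod a) /axis_frame.
have := ltn_pmod a (isT : 0 < 8)%N.
by case: (a %% 8)%N => [|[|[|[|[|[|[|[|//]]]]]]]] _ h.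
Qed.

(** With sides [d] and [e], the two 45 degree sectors of the angle are spanned by [d], [d + e] and
    by [d + e], [e]; only the diagonal point has both coordinates within 1 of the vertex. *)
Lemma right_angle_diagonal (t : angle) (q : Z2) :
  width t = 2 -> `|(dir (start t)).1| + `|(dir (start t)).2| = 1 ->
  angle_interior t q -> c2 (vertex t) q ->
  q = vertex t + dir (start t) + dir (start t + 2).
Proof.
case: t => p a w /= -> /dir_axis[[d1 eE] mE _ _] [j [m [n [/= j2 m0 jn ->]]]].
rewrite /c2 => /and3P[_].
(* For [j = 0] both [m] and [n] are positive, so the coordinate [m + n] along [d] is at least 2. For
   [j = 1] the coordinate along [e] is [m + n], which leaves [m = 1] and [n = 0]. *)
have [j0|j1] : j = 0%N \/ j = 1%N by lia.
  rewrite j0 addn0 addn1 -(addn1 a) mE eE !Z2_mulrn /= => h1 h2; nia.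
rewrite j1 addn2 -(addn2 a) mE eE !Z2_mulrn /= => h1 h2.
have mn : (m + n <= 1)%N by nia.
have -> : m = 1%N by lia.
have -> : n = 0%N by lia.
by rewrite !mulr0 !mulr1; congr pair => /=; lia.
Qed.

Lemma c1_neighbours (p d e y : Z2) : axis_frame d e -> c1 p y ->
  [\/ y = p + d, y = p + e, y = p - d | y = p - e].
Proof.
case: p d e y => [p1 p2] [d1 d2] e [y1 y2] [/= dd ->] /c1P /= py.
have [h|[h|[h|h]]] : (y1 = p1 + d1 /\ y2 = p2 + d2) \/
  (y1 = p1 - d2 /\ y2 = p2 + d1) \/ (y1 = p1 - d1 /\ y2 = p2 - d2) \/
  (y1 = p1 + d2 /\ y2 = p2 - d1) by lia.
- by apply: Or41; case: h => -> ->.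
- by apply: Or42; case: h => -> ->.
- by apply: Or43; case: h => -> ->.
- by apply: Or44; case: h => -> ->; rewrite -[in LHS](opprK d2).
Qed.

Lemma cold_set_corner (X A : set Z2) (p d e : Z2) :
  axis_frame d e -> X p -> X (p + d + e) -> ~ X (p - d) -> ~ X (p - e) ->
  cold_set c1 X A -> A p.
Proof.
move=> de Xp Xq nXd nXe [_ AX coldA]; apply: contrapT => nAp.
have [d1 eE] := de; set q := p + d + e in Xq.
pose f x := if x == p then q else x.
have fK y : X y -> c1 p y -> f p = f y \/ c1 (f p) (f y).
  move=> Xy py; have /negPf yp : y != p.
    by apply/eqP => yp; move/c1P: py; rewrite yp; lia.
  rewrite /f eqxx yp; right.
  (* The surviving cases [p + d] and [p + e] differ from [q] by [e] and [d] respectively. *)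
  by have [yE|yE|yE|yE] := c1_neighbours de py;
    do ?[by case: nXd; rewrite -yE | by case: nXe; rewrite -yE];
    apply/c1P; rewrite yE /q eE /=; lia.
have fcont : kcontinuous c1 X f.
  split=> [x Xx|x y Xx Xy xy]; first by rewrite /f; case: ifP.
  have [xp|xp] := eqVneq x p; first by rewrite xp in xy *; exact: fK.
  have [yp|yp] := eqVneq y p.
    rewrite yp c1_sym in xy *.
    by have [->|] := fK _ Xx xy; [left|rewrite c1_sym; right].
  by rewrite /f (negPf xp) (negPf yp); right.
have fA x : A x -> f x = x.
  by move=> Ax; rewrite /f; case: eqP => // xp; case: nAp; rewrite -xp.
have [n [[s [[_ sK] s0 sn]] _] n1] := coldA _ fcont fA _ Xp.
rewrite /f eqxx in sn.
have : p = q \/ c1 p q.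
  case: n n1 sn sK => [_ sq _|[|//] _ sq sK]; first by left; rewrite -s0.
  by have := sK 0%N isT; rewrite s0 sq.
(* Both cases fail because [q - p = d + e] has coordinates of absolute value 1, hence L1 norm 2. *)
rewrite /q eE => -[pq|/c1P /=]; last by lia.
have /= h1 := congr1 fst pq; have /= h2 := congr1 snd pq; lia.
Qed.

Theorem proposition5p4 (X S E1 E2 A : set Z2) (p : Z2) (theta : angle)
  (diskX : digital_disk X)
  (boundS : bounding_curve S X)
  (edge1 : edge S E1) (edge2 : edge S E2)
  (axis1 : axis_parallel E1) (axis2 : axis_parallel E2)
  (angle_theta : interior_angle S E1 E2 theta)
  (vertex_theta : vertex theta = p)
  (measure_theta : degrees theta = 90%N)
  (thick : thick90 S theta)
  (coldA : cold_set c1 X A) :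
  A p.
Proof.
have w2 : width theta = 2%N by move: measure_theta; rewrite /degrees; lia.
have [_ _ XE] := boundS; have [q [Iq tq pq _]] := thick.
have [_ EE _ sides near] := angle_theta.
have Sp : S p.
  have [Ep _] : (E1 `&` E2) p by rewrite EE.
  by have [_ ES _] := edge1; apply: ES.
move: sides; rewrite w2 vertex_theta => sides.
set a := start theta in sides.
have [d1 nSd nSe] : [/\ `|(dir a).1| + `|(dir a).2| = 1,
    ~ S (p - dir a) & ~ S (p - dir (a + 2))].
  (* Either edge may be the starting side; the two cases are symmetric. *)
  case: sides => -[l1 l2].
    have h1 := leaves_axis edge1 l1 axis1; have h2 := leaves_axis edge2 l2 axis2.
    by split=> //; [apply: edge_no_extension edge1 l1 h1
                   |apply: edge_no_extension edge2 l2 h2].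
  have h1 := leaves_axis edge2 l1 axis2; have h2 := leaves_axis edge1 l2 axis1.
  by split=> //; [apply: edge_no_extension edge2 l1 h1
                   |apply: edge_no_extension edge1 l2 h2].
have [de _ d4 d6] := dir_axis d1; have [_ eE] := de.
have qE := right_angle_diagonal w2 d1 tq pq; rewrite vertex_theta -/a in qE.
(* [j = 2] and [j = 4] index the rays opposite to the two sides. *)
have nI j r : (0 < j < 6)%N -> r = dir (a + 2 + j) ->
    `|r.1| + `|r.2| = 1 -> ~ Int S (p + r).
  move=> j6 rE r1; apply: (near (p + r) _).2.
    by rewrite vertex_theta; apply/c1_sub_c2/c1P => /=; lia.
  (* The complementary angle starts at [dir (a + 2)] and sweeps six steps; [p + r] is one unit along
     its ray [j], and [0 < j] keeps it off the starting ray. *)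
  exists j, 1%N, 0%N; rewrite /= w2 vertex_theta -/a -rE mulr1n mulr0n addr0.
  by split=> //; [lia|left; lia].
apply: (cold_set_corner de _ _ _ _ coldA); rewrite XE.
- by left.
- by right; rewrite -qE.
- case=> //; apply: (nI 2%N) => //; last by rewrite /=; lia.
  by rewrite -addnA d4.
- case=> //; apply: (nI 4%N) => //; last by rewrite eE /=; lia.
  by rewrite -addnA d6.
Qed.
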